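(* Let $T:\mathbb{C}[x_1,\dots,x_d]\to\mathbb{C}$ be a pseudo-positive definite functional. If for all $k\in\mathbb{N}_0$, $l=1,\dots,a_k$, the functional $T_{k,l}:\mathbb{C}[t]\to\mathbb{C}$ is determined in the sense of Stieltjes, then there exists at most one pseudo-positive, signed moment measure $\mu$ on $\mathbb{R}^d$ with $$T(f)=\int_{\mathbb{R}^d}f\,d\mu\qquad\text{for all } f\in\mathbb{C}[x_1,\dots,x_d].$$
   Context: Fix $d\ge 1$. $\mathbb{S}^{d-1}$ is the unit sphere of $\mathbb{R}^d$ with surface measure $d\theta$. $\mathcal{H}_k(\mathbb{R}^d)$ is the space of harmonic homogeneous complex polynomials of degree $k$, $a_k=\dim\mathcal{H}_k(\mathbb{R}^d)$, and $Y_{k,l}:\mathbb{R}^d\to\mathbb{R}$, $l=1,\dots,a_k$, is a fixed basis of $\mathcal{H}_k(\mathbb{R}^d)$, orthonormal for $\langle f,g\rangle=\int_{\mathbb{S}^{d-1}}f\overline{g}\,d\theta$. For a linear functional $T:\mathbb{C}[x_1,\dots,x_d]\to\mathbb{C}$ put $T_{k,l}(p):=T\big(p(|x|^2)Y_{k,l}(x)\big)$ for $p\in\mathbb{C}[t]$. $T$ is pseudo-positive definite if $T_{k,l}(p^*p)\ge0$ and $T_{k,l}(t\,p^*(t)p(t))\ge0$ for all $p\in\mathbb{C}[t]$ and all $k,l$, where $p^*$ has the complex conjugate coefficients of $p$. A linear functional $\phi$ on $\mathbb{C}[t]$ is determined in the sense of Stieltjes if there is exactly one non-negative measure $\tau$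 on $[0,\infty)$ with all moments finite and $\int_0^\infty r^m\,d\tau(r)=\phi(t^m)$ for all $m\in\mathbb{N}_0$. A signed measure is a real-valued $\sigma$-additive set function on the Borel sets; it is a (signed) moment measure if all polynomials are integrable with respect to its total variation. A signed measure $\mu$ on $\mathbb{R}^d$ is pseudo-positive if $\int_{\mathbb{R}^d}h(|x|)Y_{k,l}(x)\,d\mu(x)\ge0$ for every continuous compactly supported $h:[0,\infty)\to[0,\infty)$ and all $k\in\mathbb{N}_0$, $l=1,\dots,a_k$. *)

(* Defs.v *)
From HB Require Import structures.
From mathcomp Require Import all_boot all_order all_algebra.
From mathcomp Require Export complex.
(* The notations of mpoly cannot be parsed together with those of analysis. *)
From mathcomp Require Export -(notations) mpoly.
From mathcomp Require Import all_classical all_reals all_analysis.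
From mathcomp Require Import measurable_realfun.
Import numFieldNormedType.Exports.
Import Order.TTheory GRing.Theory Num.Theory.

Set Implicit Arguments.
Unset Strict Implicit.
Unset Printing Implicit Defensive.

Local Open Scope classical_set_scope.
Local Open Scope ring_scope.
Local Open Scope complex_scope.

Definition mpushforward d d' (T1 : measurableType d) (T2 : measurableType d')
    (R : realFieldType) (m : {measure set T1 -> \bar R}) (f : T1 -> T2)
    (mf : measurable_fun setT f) : {measure set T2 -> \bar R} :=
  measure_function_pushforward__canonical__measure_function_Measure m mf.

(* R^n is n.-tuple R, whose canonical sigma-algebra (generated by the         *)
(* projections) is the Borel one.                                             *)

Section lebesgue_tuple.
Context (R : realType).

Section step.
Context (n : nat) (mu : {sigma_finite_measure set (n.-tuple R) -> \bar R}).

Definition tuple_of_pair (p : measurableTypeR R * n.-tuple R) : n.+1.-tuple R :=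
  [the n.+1.-tuple R of (p.1 : R) :: p.2].

Lemma measurable_tuple_of_pair : measurable_fun setT tuple_of_pair.
Proof.
apply: (@measurable_cons _ _ _ R (fun p => p.1 : R) n (fun p => p.2)).
- exact: measurable_fst.
- exact: measurable_snd.
Qed.

Definition lebesgue_cons : set (n.+1.-tuple R) -> \bar R :=
  pushforward (@lebesgue_measure R \x mu)%E tuple_of_pair.

HB.instance Definition _ := Measure.copy lebesgue_cons
  (mpushforward (@lebesgue_measure R \x mu)%E measurable_tuple_of_pair).

Let lebesgue_cons_sigma_finite : sigma_finite setT lebesgue_cons.
Proof.
have /sigma_finiteP[F [TF ndF Foo]] := sigma_finiteT (@lebesgue_measure R).
have /sigma_finiteP[G [TG ndG Goo]] := sigma_finiteT mu.
pose hd (t : n.+1.-tuple R) : measurableTypeR R := thead t.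
pose tl (t : n.+1.-tuple R) : n.-tuple R := [tuple of behead t].
exists (fun k => hd @^-1` F k `&` tl @^-1` G k).
  apply/seteqP; split => // t _.
  have [i _ Fi] : (\bigcup_i F i) (hd t) by rewrite -TF.
  have [j _ Gj] : (\bigcup_i G i) (tl t) by rewrite -TG.
  exists (maxn i j) => //; split.
  - have /subsetPset FS := ndF _ _ (leq_maxl i j); exact: FS.
  - have /subsetPset GS := ndG _ _ (leq_maxr i j); exact: GS.
move=> k; have [mF Fk] := Foo k; have [mG Gk] := Goo k; split.
  apply: measurableI.
    rewrite -[X in measurable X]setTI.
    exact: (@measurable_tnth _ R n.+1 ord0).
  by rewrite -[X in measurable X]setTI; exact: measurable_behead.
rewrite /lebesgue_cons /pushforward.
rewrite (_ : _ @^-1` _ = F k `*` G k).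
  by rewrite product_measure1E// lte_mul_pinfty// ge0_fin_numE.
suff tlE p : tl (tuple_of_pair p) = p.2 by apply/seteqP; split => p /=; rewrite tlE.
exact/val_inj.
Qed.

HB.instance Definition _ := @Measure_isSigmaFinite.Build _ _ _ lebesgue_cons
  lebesgue_cons_sigma_finite.

End step.

Fixpoint lebesgue_tuple (n : nat) :
    {sigma_finite_measure set (n.-tuple R) -> \bar R} :=
  match n with
  | 0 => \d_([tuple] : 0.-tuple R)
  | n'.+1 => lebesgue_cons (lebesgue_tuple n')
  end.

End lebesgue_tuple.

Section sphere.
Context (R : realType) (n : nat).
Implicit Types x : n.-tuple R.

Definition enorm x : R := Num.sqrt (\sum_i tnth x i ^+ 2).

Lemma measurable_enorm : measurable_fun setT enorm.
Proof.
rewrite (_ : enorm = (fun r : R => r `^ 2^-1) \o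
    (fun x => \sum_i tnth x i ^+ 2)); last first.
  apply/funext => x; rewrite /enorm /= powR12_sqrt//.
  by apply: sumr_ge0 => i _; exact: sqr_ge0.
apply: measurableT_comp; first exact: measurable_powR.
apply: measurable_sum => i; apply: measurable_funX.
exact: measurable_tnth.
Qed.

Definition punctured_ball : set (n.-tuple R) := [set x | 0 < enorm x <= 1].

Lemma measurable_punctured_ball : measurable punctured_ball.
Proof.
rewrite (_ : punctured_ball = enorm @^-1` `]0, 1]%classic).
  by rewrite -[X in measurable X]setTI; apply: measurable_enorm.
by apply/seteqP; split => x /=; rewrite /punctured_ball /= in_itv.
Qed.

Definition radial_proj x : n.-tuple R :=
  [tuple (enorm x)^-1 * tnth x i | i < n].

Lemma measurable_radial_proj : measurable_fun setT radial_proj.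
Proof.
apply/measurable_fun_tnthP => i.
rewrite (_ : _ \o _ = (fun x => (enorm x `^ (-1)) * tnth x i)); last first.
  apply/funext => x; rewrite /= tnth_mktuple powR_inv1//.
  exact: sqrtr_ge0.
apply: measurable_funM; last exact: measurable_tnth.
apply: (@measurableT_comp _ _ _ _ _ _ (fun r : R => r `^ (-1))).
  exact: measurable_powR.
exact: measurable_enorm.
Qed.

(* Surface measure of the unit sphere, carried by the ambient space:          *)
(* sigma(A) = n * lebesgue {r t | 0 < r <= 1, t in A, |t| = 1}.               *)
Definition surface_measure : {measure set (n.-tuple R) -> \bar R} :=
  mscale (n%:R)%:nng
    (mpushforward (mrestr (lebesgue_tuple R n) measurable_punctured_ball)
      measurable_radial_proj).

End sphere.

Section complex_integral.
Context d (T : measurableType d) (R : realType).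
Implicit Types f : T -> R[i].

Definition cintegrable (m : {measure set T -> \bar R}) f : Prop :=
  m.-integrable setT (EFin \o (@complex.Re R \o f)) /\
  m.-integrable setT (EFin \o (@complex.Im R \o f)).

Definition cintegral (m : {measure set T -> \bar R}) f : R[i] :=
  (\int[m]_x complex.Re (f x))%R +i* (\int[m]_x complex.Im (f x))%R.

Section signed.
Variable mu : {charge set T -> \bar R}.

Lemma hahn_exists : exists PN : set T * set T,
  hahn_decomposition mu PN.1 PN.2.
Proof. by have [P [N PN]] := Hahn_decomposition mu; exists (P, N). Qed.

(* The Jordan decomposition and the total variation do not depend on the      *)
(* chosen Hahn decomposition.                                                 *)
Definition hahn : hahn_decomposition mu _ _ := projT2 (cid hahn_exists).

Definition total_variation : {measure set T -> \bar R} := charge_variation hahn.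

Definition charge_cintegral f : R[i] :=
  cintegral (jordan_pos hahn) f - cintegral (jordan_neg hahn) f.

End signed.
End complex_integral.

Section harmonic.
Context (R : realType) (d : nat).
Local Notation C := R[i].

Definition peval (p : mpoly d C) (x : d.-tuple R) : C :=
  meval (fun i => (tnth x i)%:C) p.

Definition laplacian (p : mpoly d C) : mpoly d C :=
  \sum_(i < d) mderiv i (mderiv i p).

Lemma mderiv_dhomog i k (p : mpoly d C) :
  p \is ishomog1 k mdeg -> mderiv i p \is ishomog1 k.-1 mdeg.
Proof.
move=> hp; apply/dhomogP => m; rewrite mcoeff_msupp mcoeff_mderiv.
apply: contraNeq => km; rewrite (dhomog_nemf_coeff hp) ?mul0rn//.
by apply: contraNneq km => <-; rewrite /= mdegD mdeg1 addn1.
Qed.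

Lemma laplacian_dhomog k (p : mpoly d C) :
  p \is ishomog1 k mdeg -> laplacian p \is ishomog1 k.-2 mdeg.
Proof.
by move=> hp; apply: rpred_sum => i _; do 2 apply: mderiv_dhomog.
Qed.

Lemma laplacian_is_linear : linear laplacian.
Proof.
move=> a p q; rewrite /laplacian scaler_sumr -big_split /=.
by apply: eq_bigr => i _; rewrite !linearP.
Qed.

Definition dhomog_laplacian k (p : dhomog d C k) : dhomog d C k.-2 :=
  DHomog (laplacian_dhomog (dhomog_is_dhomog p)).

Lemma dhomog_laplacian_is_linear k : linear (@dhomog_laplacian k).
Proof. by move=> a p q; apply: val_inj; exact: laplacian_is_linear. Qed.

HB.instance Definition _ k := GRing.isLinear.Build C (dhomog d C k)
  (dhomog d C k.-2) _ (@dhomog_laplacian k) (@dhomog_laplacian_is_linear k).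

End harmonic.

(* From here on the ambient space is R^(d+1), that is, of dimension >= 1, for *)
(* which dhomog carries its structure of finite-dimensional vector space.     *)

Section pseudo_positivity.
Context (R : realType) (d : nat).
Local Notation C := R[i].
Local Notation Rd := (d.+1.-tuple R).

(* H_k(R^(d+1)); for k < 2 the Laplacian of a k-homogeneous p vanishes.       *)
Definition harmonics k : {vspace dhomog d.+1 C k} :=
  lker (linfun (@dhomog_laplacian R d.+1 k)).

Definition harmonic_family : Type :=
  forall k, (\dim (harmonics k)).-tuple (dhomog d.+1 C k).

Definition spherical_prod (f g : mpoly d.+1 C) : C :=
  cintegral (surface_measure R d.+1) (fun x => peval f x * (peval g x)^*).

Definition real_orthonormal_basis (Y : harmonic_family) : Prop :=
  forall k,
  [/\ basis_of (harmonics k) (Y k),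
      forall l x, complex.Im (peval (tnth (Y k) l) x) = 0 &
      forall l l', spherical_prod (tnth (Y k) l) (tnth (Y k) l') = (l == l')%:R].

Definition sqnorm_mpoly : mpoly d.+1 C := \sum_(i < d.+1) mpolyX C (mnm1 i) ^+ 2.

Definition radial_functional (T : {scalar mpoly d.+1 C}) (Ykl : mpoly d.+1 C)
    (p : {poly C}) : C :=
  T (horner_alg sqnorm_mpoly p * Ykl).

Lemma radial_functional_is_linear T Ykl : linear_for *%R (radial_functional T Ykl).
Proof.
by move=> a p q; rewrite /radial_functional linearP /= mulr_algl mulrDl -scalerAl linearP.
Qed.

HB.instance Definition _ T Ykl :=
  GRing.isLinear.Build C {poly C} C *%R (radial_functional T Ykl)
    (radial_functional_is_linear T Ykl).

Definition pseudo_positive_definite (Y : harmonic_family)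
    (T : {scalar mpoly d.+1 C}) : Prop :=
  forall k l (p : {poly C}),
    let Tkl := radial_functional T (tnth (Y k) l) in
    let pstar := map_poly (@conjc R) p in
    0 <= Tkl (pstar * p) /\ 0 <= Tkl ('X * pstar * p).

Definition moment_measure (mu : {charge set Rd -> \bar R}) : Prop :=
  forall f : mpoly d.+1 C, cintegrable (total_variation mu) (peval f).

Definition pseudo_positive (Y : harmonic_family)
    (mu : {charge set Rd -> \bar R}) : Prop :=
  forall h : R -> R,
    {within `[0, +oo[, continuous h} ->
    (forall r, 0 <= r -> 0 <= h r) ->
    compact (closure [set r | 0 <= r /\ h r != 0]) ->
  forall k l,
    0 <= charge_cintegral mu
           (fun x => (h (enorm x))%:C * peval (tnth (Y k) l) x).

End pseudo_positivity.

Section stieltjes.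
Context (R : realType).

(* A measure on [0, +oo[ is a Borel measure on R that vanishes on ]-oo, 0[.   *)
Definition stieltjes_solution (phi : {scalar {poly R[i]}})
    (tau : {measure set R -> \bar R}) : Prop :=
  [/\ tau `]-oo, 0[%classic = 0%E,
      forall m, tau.-integrable `[0, +oo[ (fun r => (r ^+ m)%:E) &
      forall m, (\int[tau]_(r in `[0%R, +oo[) (r ^+ m))%:C = phi 'X^m].

Definition stieltjes_determined (phi : {scalar {poly R[i]}}) : Prop :=
  (exists tau, stieltjes_solution phi tau) /\
  (forall tau tau', stieltjes_solution phi tau -> stieltjes_solution phi tau' ->
    forall A, measurable A -> tau A = tau' A).

End stieltjes.

(* Main.v *)
(* For fixed (k, l), pseudo-positivity says that the pushforward of Y_kl mu   *)
(* under x |-> |x|^2 is a non-negative measure on [0, +oo[, and its moments   *)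
(* are those of T_kl. By determinacy it is the same for mu and nu, so that    *)
(* mu and nu have the same integrals of 1_{|x|^2 <= rho} |x|^(2j) Y_kl. Since *)
(* every polynomial is a combination of the |x|^(2j) Y_kl, mu and nu have the *)
(* same polynomial moments on every ball. There the indicators of finite      *)
(* intersections of half-spaces {x_i < c} are bounded pointwise limits of     *)
(* polynomials, built from (1 - u^k)^(k 2^k), which tends to 1_{u < 1/2} on   *)
(* [0, 1]; intersected with balls, these sets form a generating pi-system.    *)
From HB Require Import structures.
Require Import Defs.
From mathcomp Require Import all_boot all_order all_algebra.
From mathcomp Require Import all_classical all_reals all_analysis.
From mathcomp Require Import measurable_realfun ring lra.
Import numFieldNormedType.Exports.
Import Order.TTheory GRing.Theory Num.Theory.

Set Implicit Arguments.
Unset Strict Implicit.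
Unset Printing Implicit Defensive.

Local Open Scope classical_set_scope.
Local Open Scope ring_scope.
Local Open Scope complex_scope.

(** * Decomposition of polynomials into harmonics *)

(** Pseudo-positivity splits the uniqueness question for a signed measure into one-dimensional
    questions about non-negative measures. The image of [Y_kl mu] under x |-> |x|^2 is a
    non-negative measure on the half-line that solves the Stieltjes problem of [T_kl]
    ([radial_stieltjes_solution]), so determinacy makes it the same for [mu] and [nu]. Equal
    measures may be tested on more than polynomials: the function 1_[0, rho](t) t^j yields equal
    integrals of |x|^(2j) Y_kl over every ball ([ball_integral_sqnormXM]). By the Almansi
    decomposition ([sqnorm_harmonic_ind]) these products span all polynomials, so all polynomial
    moments agree on every ball ([ball_integral_mpoly]). On a ball polynomials approximate enough
    indicators boundedly ([charge_sqball_halfspaces]), and a pi-system argument for charges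
    concludes ([charge_unique]).

    The non-negative image measure has to be constructed. A charge is a difference P - N and Y_kl
    changes sign, so the image is at first a difference beta - alpha of two finite measures.
    [positive_of_trapezoid] passes from continuous test functions to half-open intervals, which
    gives alpha <= beta there, and [measure_subtraction] turns the difference into a measure. *)

Section almansi.
Context (R : realType) (d : nat).
Local Notation C := R[i].
Local Notation poly := (mpoly d.+1 C).
Local Notation var i := (mpolyX C (mnm1 i)).
Local Notation S := (sqnorm_mpoly R d).
Implicit Types p q g h : poly.

HB.instance Definition _ := GRing.isLinear.Build C poly poly _
  (@laplacian R d.+1) (@laplacian_is_linear R d.+1).

Lemma euler_dhomog k p : p \is ishomog1 k mdeg ->
  \sum_i var i * mderiv i p = k%:R *: p.
Proof.
move=> /dhomogP hp; rewrite {1}[p]mpolyE.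
under eq_bigr do rewrite linear_sum mulr_sumr.
rewrite exchange_big /= [in RHS](mpolyE p) scaler_sumr.
apply: eq_big_seq => m /hp <-.
rewrite scalerA mulrC -scalerA /= mdegE natr_sum scaler_suml scaler_sumr.
apply: eq_bigr => i _.
rewrite mderivZ mderivX -!scalerAr; congr (_ *: _).
(* Subtraction of exponents is truncated, so an exponent 0 is treated apart; there the coefficient
   [m i] vanishes. *)
have [->|mi] := eqVneq (m i) 0%N; first by rewrite !scale0r.
congr (_ *: _); rewrite -mpolyXD; congr (mpolyX _ _).
apply/mnmP => j; rewrite mnmDE mnmBE mnm1E.
by case: eqP => [<-|] /=; rewrite ?add0n ?subn0// add1n subn1 prednK// lt0n.
Qed.

Lemma mderiv_sqnorm i : mderiv i S = 2 *: var i.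
Proof.
rewrite linear_sum (bigD1 i)//= big1 => [|j ji].
  rewrite addr0 expr2 mderivM mderivX mnm1E eqxx scale1r.
  rewrite (_ : mpolyX C _ = 1) ?mul1r ?mulr1 ?scaler_nat//.
  by rewrite -[1]mpolyX0; congr (mpolyX _ _); apply/mnmP => j; rewrite mnmBE subnn mnmE.
by rewrite expr2 mderivM mderivX mnm1E (negbTE ji) scale0r mul0r mulr0 addr0.
Qed.

Lemma laplacian_sqnormM g :
  laplacian (S * g) = (2 * d.+1)%:R *: g + 4 *: (\sum_i var i * mderiv i g)
                      + S * laplacian g.
Proof.
rewrite /laplacian.
under eq_bigr => i _.
  rewrite mderivM mderiv_sqnorm mderivD !mderivM mderiv_sqnorm mderivZ.
  rewrite mderivX mnm1E eqxx scale1r.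
  rewrite (_ : mpolyX C (mnm_sub _ _) = 1); last first.
    rewrite -[1]mpolyX0; congr (mpolyX _ _).
    by apply/mnmP => j; rewrite mnmBE subnn mnmE.
  rewrite -!scalerAl mul1r -addrA [Z in _ + Z]addrA -scalerDl addrA.
  over.
rewrite !big_split/= mulr_sumr; congr (_ + _ + _).
  by rewrite sumr_const card_ord scalerMnl natrM mulr_natr.
by rewrite scaler_sumr; apply: eq_bigr => i _; congr (_ *: _); rewrite -natrD.
Qed.

Lemma sqnorm_dhomog : S \is ishomog1 2 mdeg.
Proof.
apply: rpred_sum => i _; rewrite expr2 -mpolyXD dhomogX.
by rewrite /= mdegD mdeg1.
Qed.

Lemma sqnormXM_dhomog j k h : h \is ishomog1 k mdeg ->
  S ^+ j * h \is ishomog1 (2 * j + k) mdeg.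
Proof. by move=> hh; apply: dhomogM => //; exact/dhomogMn/sqnorm_dhomog. Qed.

(** The product rule for [S * g] and Euler's identity for the homogeneous [S ^+ j * h] reduce every
    term to a multiple of [S ^+ j * h]. *)
Lemma laplacian_sqnormXM_harmonic k h : h \is ishomog1 k mdeg ->
    laplacian h = 0 ->
  forall j, exists2 c : C, c != 0 & laplacian (S ^+ j.+1 * h) = c *: (S ^+ j * h).
Proof.
move=> hk h0 j.
(* With natural coefficients the terms cannot cancel; c is nonzero in C because the characteristic
   is 0. *)
suff [c c0 E] : exists2 c : nat, (0 < c)%N &
    laplacian (S ^+ j.+1 * h) = c%:R *: (S ^+ j * h).
  by exists c%:R => //; rewrite pnatr_eq0 -lt0n.
elim: j => [|j [c c0 IH]].
  exists (2 * d.+1 + 4 * k)%N; first by rewrite mulnS addnAC.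
  rewrite expr1 expr0 mul1r laplacian_sqnormM h0 mulr0 addr0 (euler_dhomog hk).
  by rewrite scalerA -scalerDl natrD (natrM _ 4).
exists (2 * d.+1 + 4 * (2 * j.+1 + k) + c)%N; first by rewrite addn_gt0 c0 orbT.
rewrite exprS -mulrA laplacian_sqnormM IH (euler_dhomog (sqnormXM_dhomog _ hk)).
rewrite -scalerAr mulrA -exprS scalerA -scalerDl -scalerDl.
by rewrite !natrD (natrM _ 4) natrD.
Qed.

Lemma iter_laplacian_sqnormXM_harmonic k h : h \is ishomog1 k mdeg ->
    laplacian h = 0 ->
  forall j, exists2 c : C, c != 0 &
    iter j (@laplacian R d.+1) (S ^+ j * h) = c *: h.
Proof.
move=> hk h0; elim=> [|j [c c0 IH]].
  by exists 1; rewrite ?oner_eq0// expr0 mul1r scale1r.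
have [c' c'0 E] := laplacian_sqnormXM_harmonic hk h0 j.
exists (c' * c); first by rewrite mulf_neq0.
rewrite iterSr E -scalerA -IH.
elim: j {IH E} (S ^+ j * h) => //= j IH g.
by rewrite IH linearZ.
Qed.

Lemma iter_laplacian_dhomog s k p : p \is ishomog1 k mdeg ->
  iter s (@laplacian R d.+1) p \is ishomog1 (k - 2 * s) mdeg.
Proof.
move=> hp; elim: s => [|s IH]; first by rewrite muln0 subn0.
rewrite iterS (_ : (k - 2 * s.+1 = (k - 2 * s).-2)%N); first exact: laplacian_dhomog.
by rewrite mulnS addnC subnDA subn2.
Qed.

Lemma laplacian_dhomog_small k p : (k < 2)%N -> p \is ishomog1 k mdeg ->
  laplacian p = 0.
Proof.
move=> k2 hp; rewrite /laplacian big1// => i _.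
have /dhomogP h0 : mderiv i p \is ishomog1 0 mdeg.
  by have := mderiv_dhomog i hp; case: k k2 {hp} => [|[|]].
rewrite [mderiv i p]mpolyE linear_sum big1_seq//= => m /h0 /eqP.
by rewrite /= mdeg_eq0 => /eqP ->; rewrite mderivZ mpolyX0 mderivC scaler0.
Qed.

(* If [iter s.+1 laplacian p = 0], then [h = iter s laplacian p] is harmonic,  *)
(* and [p] minus a multiple of [S ^+ s * h] is killed by [iter s laplacian].   *)
Lemma sqnorm_harmonic_ind (Y : harmonic_family R d) (K : poly -> Prop) :
    (forall k, basis_of (harmonics R d k) (Y k)) ->
    K 0 -> (forall c p q, K p -> K q -> K (c *: p + q)) ->
    (forall j k l, K (S ^+ j * tnth (Y k) l)) ->
  forall p, K p.
Proof.
move=> bY K0 KD KY.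
have KZ c p : K p -> K (c *: p).
  by move=> Kp; rewrite -[_ *: _]addr0; exact: KD.
have Ksum (I : Type) (r : seq I) (F : I -> poly) :
    (forall i, K (F i)) -> K (\sum_(i <- r) F i).
  move=> KF; elim: r => [|i r IH]; first by rewrite big_nil.
  by rewrite big_cons -[F i]scale1r; exact: KD.
have KH j k p : p \is ishomog1 k mdeg -> laplacian p = 0 -> K (S ^+ j * p).
  move=> hp p0.
  have : DHomog hp \in harmonics R d k.
    rewrite memv_ker lfunE /=; apply/eqP/val_inj => /=; exact: p0.
  move=> /(coord_basis (bY k)) /(congr1 val) /=; rewrite linear_sum/= => ->.
  rewrite mulr_sumr; apply: Ksum => l.
  by rewrite -scalerAr -tnth_nth; exact/KZ/KY.
(* For [s.+1] the bound reads 2s <= k, so that k - 2s is a true difference and [S ^+ s * h] has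
   degree exactly k, like p. *)
have KI : forall s k p, (2 * s <= k.+2)%N -> p \is ishomog1 k mdeg ->
    iter s (@laplacian R d.+1) p = 0 -> K p.
  elim=> [k p _ _ /= -> //|s IH k p sk hp p0].
  have s2k : (2 * s <= k)%N by rewrite -(leq_add2l 2) -mulnS.
  pose h := iter s (@laplacian R d.+1) p.
  have hh : h \is ishomog1 (k - 2 * s) mdeg by exact: iter_laplacian_dhomog.
  have [c c0 E] := iter_laplacian_sqnormXM_harmonic hh p0 s.
  have -> : p = c^-1 *: (S ^+ s * h) + (p - c^-1 *: (S ^+ s * h)) by rewrite addrC subrK.
  apply: KD; first exact: KH hh p0.
  apply: IH.
  - exact: leq_trans s2k (leqW (leqnSn _)).
  - rewrite rpredB// rpredZ//.
    by have := sqnormXM_dhomog s hh; rewrite subnKC.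
  - rewrite (_ : iter _ _ _ = h - c^-1 *: iter s (@laplacian R d.+1) (S ^+ s * h)).
      by rewrite E scalerA mulVf// scale1r subrr.
    rewrite /h; elim: s {h hh E sk s2k p0} (S ^+ s * h) => //= s IH q.
    by rewrite IH linearB linearZ.
(* The homogeneous part of degree k is killed by k/2 + 1 Laplacians, since after k/2 of them the
   degree is at most 1. *)
move=> p; rewrite (pihomog_partitionE (mf := mdeg) (leqnn (msize p))).
rewrite -(big_mkord xpredT (fun i => pihomog mdeg i p)).
apply: Ksum => k; apply: (KI (k./2.+1) k) => //.
- by rewrite mulnS !add2n !ltnS mul2n -[leqRHS]odd_double_half leq_addl.
- exact: pihomogP.
rewrite iterS; apply: (@laplacian_dhomog_small (k - 2 * k./2)).
  rewrite -[X in (X - _)%N]odd_double_half mul2n addnK.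
  by case: (odd k).
exact/iter_laplacian_dhomog/pihomogP.
Qed.

End almansi.

(** * Polynomial approximation of step functions *)

Section polynomial_step.
Variable R : realType.
Implicit Types (u v : R) (k n : nat).

Lemma bernoulli_ineq n v : -1 <= v -> 1 + n%:R * v <= (1 + v) ^+ n.
Proof.
move=> v1; elim: n => [|n IH]; first by rewrite mul0r addr0 expr0.
rewrite exprS; apply: (@le_trans _ _ ((1 + v) * (1 + n%:R * v))); last first.
  by rewrite ler_wpM2l// -lerBlDl sub0r.
rewrite -natr1; have : 0 <= n%:R * v ^+ 2 by rewrite mulr_ge0// sqr_ge0.
lra.
Qed.

(** The exponent N = k 2^k is chosen so that N u^k = k (2u)^k, which tends to 0 for 0 <= u < 1/2 and
    is at least k for u >= 1/2, the point 1/2 included. *)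
Definition poly_step k u : R := (1 - u ^+ k) ^+ (k * 2 ^ k).

Lemma poly_step_ge0 k u : 0 <= u <= 1 -> 0 <= poly_step k u.
Proof. by move=> /andP[u0 u1]; rewrite exprn_ge0// subr_ge0 exprn_ile1. Qed.

Lemma poly_step_le1 k u : 0 <= u <= 1 -> poly_step k u <= 1.
Proof.
move=> /andP[u0 u1]; rewrite exprn_ile1 ?subr_ge0 ?exprn_ile1//.
by rewrite gerBl exprn_ge0.
Qed.

Lemma cvg_natrM_expr r : 0 <= r < 1 -> n%:R * r ^+ n @[n --> \oo] --> (0 : R).
Proof.
(* As r <= s^2, one factor s^n absorbs n: Bernoulli's inequality for s^-1 = 1 + e bounds n s^n by
   1/e, and the other s^n tends to 0. *)
move=> /andP[r0 r1]; pose s := (1 + r) / 2.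
have s0 : 0 < s by rewrite /s; lra.
have s1 : s < 1 by rewrite /s; lra.
have rs : r <= s ^+ 2.
  rewrite /s; have := sqr_ge0 (1 - r); rewrite !expr2; lra.
pose e := s^-1 - 1; have e0 : 0 < e by rewrite subr_gt0 invf_gt1.
have e0' := ltW e0; have s0' := ltW s0.
have le_n n : n%:R * r ^+ n <= e^-1 * s ^+ n.
  have h : n%:R * s ^+ n <= e^-1.
    rewrite -[leLHS](mulfK (lt0r_neq0 e0)) ler_piMl ?invr_ge0//.
    rewrite mulrAC -ler_pdivlMr ?exprn_gt0// div1r -exprVn.
    apply: (@le_trans _ _ (1 + n%:R * e)); first by rewrite lerDr.
    rewrite (_ : s^-1 = 1 + e); last by rewrite /e addrC subrK.
    by apply: bernoulli_ineq; rewrite (le_trans _ (ltW e0))// lerN10.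
  apply: (@le_trans _ _ (n%:R * (s ^+ 2) ^+ n)).
    by rewrite ler_wpM2l// lerXn2r// nnegrE ?exprn_ge0.
  by rewrite exprAC expr2 mulrA ler_wpM2r ?exprn_ge0.
apply: (@squeeze_cvgr _ _ _ _ (cst 0) (fun n => e^-1 * s ^+ n)).
- apply: nearW => n; rewrite le_n andbT.
  by rewrite mulr_ge0// exprn_ge0.
- exact: cvg_cst.
- rewrite -[X in _ --> X](mulr0 e^-1); apply: cvgM; first exact: cvg_cst.
  by apply: cvg_expr; rewrite gtr0_norm.
Qed.

(** Below 1/2, Bernoulli's inequality gives the lower bound 1 - k (2u)^k. From 1/2 on, (1 - u^k)^N
    (1 + u^k)^N <= 1 while (1 + u^k)^N >= 1 + N u^k >= k + 1, so the value is at most 1/(k + 1). *)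
Lemma cvg_poly_step u : 0 <= u <= 1 ->
  poly_step k u @[k --> \oo] --> ((u < 2^-1)%R%:R : R).
Proof.
move=> u01; have /andP[u0 u1] := u01; case: ltP => [ult|uge].
  have r01 : 0 <= 2 * u < 1.
    rewrite mulr_ge0//=; rewrite -ltr_pdivlMl// mulr1 //.
  apply: (@squeeze_cvgr _ _ _ _ (fun k => 1 - k%:R * (2 * u) ^+ k) (cst 1)).
  - apply: nearW => k; rewrite poly_step_le1// andbT /poly_step.
    rewrite exprMn mulrA -natrX -natrM -mulrN; apply: bernoulli_ineq.
    by rewrite lerN2 exprn_ile1.
  - rewrite -[X in _ --> X]subr0; apply: cvgB; first exact: cvg_cst.
    exact: cvg_natrM_expr.
  - exact: cvg_cst.
apply: (@squeeze_cvgr _ _ _ _ (cst 0) (fun k => k.+1%:R^-1)).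
- apply: nearW => k; rewrite poly_step_ge0//=.
  have v0 : 0 <= u ^+ k by rewrite exprn_ge0.
  rewrite -[leRHS]mul1r ler_pdivlMr//.
  apply: (@le_trans _ _ (poly_step k u * (1 + u ^+ k) ^+ (k * 2 ^ k))).
    rewrite ler_wpM2l ?poly_step_ge0//.
    apply: (@le_trans _ _ (1 + (k * 2 ^ k)%:R * u ^+ k)); last first.
      by apply: bernoulli_ineq; rewrite (le_trans _ v0)// lerN10.
    rewrite -natr1 addrC lerD2l natrM -mulrA ler_peMr// natrX -exprMn.
    by rewrite exprn_ege1// -ler_pdivrMl// mulr1.
  rewrite /poly_step -exprMn -subr_sqr expr1n exprn_ile1//.
  + by rewrite subr_ge0 -exprM exprn_ile1.
  + by rewrite gerBl sqr_ge0.
- exact: cvg_cst.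
- exact: cvg_harmonic.
Qed.

End polynomial_step.

(** * Weighted, subtracted and pushed-forward measures *)

(** The measure with density f. Both proofs are arguments so that the measure structure can be
    attached to the term itself. *)
Definition weighted_measure dT (T : measurableType dT) (R : realType)
    (P : {measure set T -> \bar R}) (f : T -> R) of (forall x, 0 <= f x) &
    P.-integrable setT (EFin \o f) :=
  fun A => (\int[P]_(x in A) (f x)%:E)%E.

Section weighted_measure.
Context dT (T : measurableType dT) (R : realType).
Variables (P : {finite_measure set T -> \bar R}) (f : T -> R).
Hypotheses (f0 : forall x, 0 <= f x) (fi : P.-integrable setT (EFin \o f)).
Local Open Scope ereal_scope.

Local Notation w := (weighted_measure f0 fi).

Let mf : measurable_fun setT (EFin \o f).
Proof. exact: measurable_int fi. Qed.

Let w0 : w set0 = 0. Proof. exact: integral_set0. Qed.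

Let w_ge0 A : 0 <= w A.
Proof. by apply: integral_ge0 => x _; rewrite lee_fin. Qed.

Let w_sigma_additive : semi_sigma_additive w.
Proof.
by apply: semi_sigma_additive_nng_induced.
Qed.

HB.instance Definition _ := isMeasure.Build _ _ _ w
  w0 w_ge0 w_sigma_additive.

Let w_finite : fin_num_fun w.
Proof.
by move=> A mA; apply: integrable_fin_num => //; exact: integrableS fi.
Qed.

HB.instance Definition _ := @Measure_isFinite.Build _ _ _ w w_finite.

(** The Radon-Nikodym derivative of w has the same integral as f over every measurable set, hence
    equals f almost everywhere; the formula is then the change of variables for that derivative. *)
Lemma ge0_integral_weighted (g : T -> \bar R) :
  measurable_fun setT g -> (forall x, 0 <= g x) ->
  \int[w]_x g x = \int[P]_x (g x * (f x)%:E).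
Proof.
move=> mg g0.
have wP : w `<< P.
  apply/null_content_dominatesP => A mA PA0.
  apply: null_set_integral => //; exact: measurable_funTS.
rewrite -(Radon_Nikodym_SigmaFinite.change_of_variables wP)//.
apply: ae_eq_integral => //.
- apply: emeasurable_funM => //.
  exact: measurable_int (Radon_Nikodym_SigmaFinite.f_integrable wP).
- exact: emeasurable_funM.
- apply: ae_eqe_mul2l; apply: integral_ae_eq => //.
  exact: Radon_Nikodym_SigmaFinite.f_integrable.
- by move=> A _ mA; rewrite -Radon_Nikodym_SigmaFinite.f_integral.
Qed.

End weighted_measure.

Lemma weighted_pushforward dT (T : measurableType dT) (R : realType)
    (P : {finite_measure set T -> \bar R}) (f q : T -> R) :
    (forall x, 0 <= f x) -> P.-integrable setT (EFin \o f) ->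
    measurable_fun setT q ->
  exists alpha : {measure set R -> \bar R},
    forall g : R -> \bar R, measurable_fun setT g -> (forall t, 0 <= g t)%E ->
    (\int[alpha]_t g t = \int[P]_x (g (q x) * (f x)%:E))%E.
Proof.
move=> f0 fi mq; exists (mpushforward (weighted_measure f0 fi) mq) => g mg g0.
rewrite ge0_integral_pushforward// preimage_setT ge0_integral_weighted//.
  exact: measurableT_comp.
by move=> x; exact: g0.
Qed.

Section subtraction_of_measures.
Variable R : realType.

(** Continuity from above, available as the mass is finite, gives the limit along x + 1/(n + 1);
    monotonicity extends it to all y > x close to x. *)
Lemma cdf_finite_right_continuous (alpha : {measure set R -> \bar R}) :
    (alpha setT < +oo)%E ->
  right_continuous (fun x => fine (alpha `]-oo, x]%classic)).
Proof.
move=> fa x; have fin A : measurable A -> alpha A \is a fin_num.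
  move=> mA; rewrite ge0_fin_numE// (le_lt_trans _ fa)//.
  by apply: le_measure; rewrite ?inE.
have homo u v : u <= v -> fine (alpha `]-oo, u]%classic) <= fine (alpha `]-oo, v]%classic).
  move=> uv; apply: fine_le; try exact: fin.
  by apply: le_measure; rewrite ?inE//; exact: subset_itvl.
have cvgs : fine (alpha `]-oo, x + n.+1%:R^-1]%classic) @[n --> \oo] -->
    fine (alpha `]-oo, x]%classic).
  apply: fine_cvg; rewrite fineK; last exact: fin.
  rewrite (@itvNycEbigcap R false); apply: nonincreasing_cvg_mu => //.
  - by rewrite -ge0_fin_numE//; exact: fin.
  - exact: bigcap_measurable.
  - move=> m n mn; apply/subsetPset/subset_itvl.
    by rewrite bnd_simp lerD2l lef_pV2 ?posrE// ler_nat.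
apply/cvgrPdist_lt => e e0; move/cvgrPdist_lt : cvgs => /(_ _ e0)[n _ /(_ n (leqnn n))/= Hn].
near=> y; have xy : x < y by [].
rewrite ler0_norm ?subr_le0 ?homo ?ltW// opprB.
apply: (le_lt_trans _ Hn); rewrite ler0_norm ?subr_le0 ?homo ?lerDl// opprB lerD2r homo//.
near: y; apply: nbhs_right_le; rewrite ltrDl//.
Unshelve. all: by end_near. Qed.

Lemma lebesgue_stieltjes_measure_ocitv (f : cumulative R R) (a b : R) : a <= b ->
  lebesgue_stieltjes_measure f `]a, b]%classic = (f b - f a)%:E.
Proof.
move=> ab; rewrite /lebesgue_stieltjes_measure /measure_extension/=.
rewrite measurable_mu_extE/=; last exact: is_ocitv.
by rewrite wlength_itv_bnd.
Qed.

(* The difference of the distribution functions of [beta] and [alpha] is      *)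
(* cumulative, and [tau] is its Lebesgue-Stieltjes measure.                   *)
Lemma measure_subtraction (alpha beta : {measure set R -> \bar R}) :
    (alpha setT < +oo)%E -> (beta setT < +oo)%E ->
    (forall a b : R, (a < b)%R -> alpha `]a, b]%classic <= beta `]a, b]%classic)%E ->
  exists tau : {measure set R -> \bar R},
    forall A, measurable A -> (tau A + alpha A = beta A)%E.
Proof.
move=> fa fb ab.
have fin (m : {measure set R -> \bar R}) A : (m setT < +oo)%E -> measurable A ->
    m A \is a fin_num.
  move=> fm mA; rewrite ge0_fin_numE// (le_lt_trans _ fm)//.
  by apply: le_measure; rewrite ?inE.
pose F x := fine (beta `]-oo, x]%classic) - fine (alpha `]-oo, x]%classic).
have FE a b : a <= b -> (F b - F a)%:E = (beta `]a, b]%classic - alpha `]a, b]%classic)%E.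
  move=> ale; rewrite /F.
  have split (m : {measure set R -> \bar R}) : (m setT < +oo)%E ->
      fine (m `]-oo, b]%classic) = fine (m `]-oo, a]%classic) + fine (m `]a, b]%classic).
    move=> fm; rewrite -fineD; try exact: fin.
    rewrite -measureU//; first by rewrite -itv_bndbnd_setU.
    apply/seteqP; split => // t [/=]; rewrite !in_itv/= => ta /andP[+ _].
    by rewrite ltNge ta.
  rewrite !split// -[in RHS](fineK (fin beta `]a, b]%classic fb _))//.
  rewrite -[in RHS](fineK (fin alpha `]a, b]%classic fa _))// -EFinB; congr (_%:E).
  ring.
have Fnd : nondecreasing F.
  move=> a b; rewrite le_eqVlt => /predU1P[-> //|lt_ab].
  rewrite -subr_ge0 -lee_fin (FE _ _ (ltW lt_ab)) sube_ge0 ?ab//.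
  by rewrite !fin.

have Frc : right_continuous F.
  by move=> x; apply: cvgB; exact: cdf_finite_right_continuous.
pose Fc : cumulative R R := HB.pack F (isCumulative.Build R _ R F Fnd Frc).
pose tau0 : {measure set (measurableTypeR R) -> \bar R} := lebesgue_stieltjes_measure Fc.
(* [measurableTypeR R] and [R] have the same measurable sets under two structures; pushing forward
   along the identity moves the measure from one to the other. *)
have idm : measurable_fun setT (fun x : measurableTypeR R => x : R).
  by move=> _ A mA; rewrite setTI.
pose tau : {measure set R -> \bar R} := mpushforward tau0 idm.
exists tau => A mA; rewrite -measure_addE.
have tauE (a b : R) : a <= b -> tau `]a, b]%classic = (F b - F a)%:E.
  by move=> ale; exact: (lebesgue_stieltjes_measure_ocitv Fc).
have mE : measurable = <<s @ocitv R >> :> set (set R) by [].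
apply: (measure_unique (@ocitv R) (fun n => `]- n%:R, n%:R]%classic)) => //.
- exact: ocitvI.
- by move=> n; exact: is_ocitv.
- rewrite -subTset => x _; exists (Num.bound `|x|) => //=.
  have := archi_boundP (normr_ge0 x); rewrite ltr_norml in_itv/=.
  by move=> /andP[-> /ltW].
- move=> _ [[a b] _ <-] /=.
  transitivity (tau `]a, b]%classic + alpha `]a, b]%classic)%E; first exact: measure_addE.
  have [leab|ba] := leP a b; last first.
    by rewrite set_itv_ge ?measure0 ?adde0// bnd_simp -leNgt ltW.
  by rewrite tauE// FE// subeK// fin.
- move=> n.
  pose I : set R := `]- n%:R, n%:R]%classic; suff : (tau I + alpha I < +oo)%E.
    by apply: le_lt_trans; rewrite le_eqVlt -measure_addE eqxx.
  rewrite /I tauE ?lte_add_pinfty ?ltry//.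
    by rewrite -ge0_fin_numE// fin.
  by rewrite -subr_ge0 opprK addr_ge0.
Qed.
End subtraction_of_measures.

(** * Continuous approximation of indicators of half-open intervals *)

Section trapezoid.
Variable R : realType.

(** For a < b and n large it rises from 0 at a to 1 at a + 1/n, and falls from 1 at b to 0 at b +
    1/n. Both ramps lie to the right of their endpoint, so the pointwise limit is the indicator of
    ]a, b], the intervals on which a Lebesgue-Stieltjes measure is computed. *)
Definition trapezoid (a b : R) (n : nat) (t : R) : R :=
  Num.max 0 (Num.min 1 (Num.min (n%:R * (t - a)) (1 + n%:R * (b - t)))).

Lemma trapezoid_ge0 a b n t : 0 <= trapezoid a b n t.
Proof. by rewrite le_max lexx. Qed.

Lemma trapezoid_le1 a b n t : trapezoid a b n t <= 1.
Proof. by rewrite ge_max ler01 ge_min lexx. Qed.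

Lemma trapezoid_out a b n t : b + 1 < t -> trapezoid a b n.+1 t = 0.
Proof.
move=> bt; apply/max_idPl; rewrite !ge_min; apply/orP; right; apply/orP; right.
have : 1 <= n.+1%:R :> R by rewrite ler1n.
nra.
Qed.

Lemma continuous_trapezoid a b n : continuous (trapezoid a b n).
Proof.
apply: (@max_fun_continuous _ R R (cst 0)); first exact: cst_continuous.
apply: (@min_fun_continuous _ R R (cst 1)); first exact: cst_continuous.
apply: (@min_fun_continuous _ R R) => t.
- by apply: cvgM; [exact: cvg_cst|apply: cvgB; [exact: cvg_id|exact: cvg_cst]].
- apply: cvgD; first exact: cvg_cst.
  by apply: cvgM; [exact: cvg_cst|apply: cvgB; [exact: cvg_cst|exact: cvg_id]].
Qed.

Lemma cvg_trapezoid a b t :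
  trapezoid a b n.+1 t @[n --> \oo] --> (\1_(`]a, b]%classic) t : R).
Proof.
have big (c : R) : 0 < c -> \forall n \near \oo, 1 <= n.+1%:R * c.
  move=> c0; near=> n; rewrite -ler_pdivrMr//.
  apply: (@le_trans _ _ n%:R); last by rewrite ler_nat.
  by near: n; exact: nbhs_infty_ger.
apply: cvg_near_cst; rewrite indicE; have [|] := boolP (t \in _); last first.
  rewrite notin_setE/= in_itv/= => /negP; rewrite negb_and -leNgt -ltNge.
  move=> /orP[le_ta|lt_bt].
    apply: nearW => n; apply/max_idPl; rewrite ge_min; apply/orP; right.
    by rewrite ge_min mulr_ge0_le0// subr_le0.
  near=> n; have h : 1 <= n.+1%:R * (t - b) by near: n; apply: big; rewrite subr_gt0.
  apply/max_idPl; rewrite !ge_min; apply/orP; right; apply/orP; right.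
  by rewrite -opprB mulrN subr_le0.
rewrite inE/= in_itv/= => /andP[lt_at le_tb].
near=> n; have h : 1 <= n.+1%:R * (t - a) by near: n; apply: big; rewrite subr_gt0.
rewrite /trapezoid min_l ?max_r// le_min h/= lerDl.
by rewrite mulr_ge0// subr_ge0.
Unshelve. all: by end_near. Qed.

End trapezoid.

Lemma Rintegral_dominated_cvg dT (T : measurableType dT) (R : realType)
    (mu : {measure set T -> \bar R}) (f_ : nat -> T -> R) (f g : T -> R) :
    (forall n, measurable_fun setT (f_ n)) -> measurable_fun setT f ->
    (forall x, f_ n x @[n --> \oo] --> f x) ->
    mu.-integrable setT (EFin \o g) -> (forall n x, `|f_ n x| <= g x) ->
  \int[mu]_x f_ n x @[n --> \oo] --> \int[mu]_x f x.
Proof.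
move=> mf_ mf cvgf ig domf.
have [] := @dominated_convergence _ _ _ mu setT measurableT
  (fun n => EFin \o f_ n) (EFin \o f) (EFin \o g).
- by move=> n; exact/measurable_EFinP.
- exact/measurable_EFinP.
- by apply: aeW => x _; apply: cvg_EFin; [exact: nearW|exact: cvgf].
- exact: ig.
- by apply: aeW => x n _; rewrite lee_fin.
move=> fi _ h.
by apply: fine_cvg; rewrite fineK//; exact: integrable_fin_num.
Qed.

(** * Images of signed weighted measures and their positivity *)

Section signed_pushforward.
Context dT (T : measurableType dT) (R : realType).
Variables (P N : {finite_measure set T -> \bar R}).

Definition diff_integral (f : T -> R) : R := \int[P]_x f x - \int[N]_x f x.

Definition diff_integrable (f : T -> R) : Prop :=
  P.-integrable setT (EFin \o f) /\ N.-integrable setT (EFin \o f).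

Variables (y q : T -> R).
Hypotheses (yi : diff_integrable y) (mq : measurable_fun setT q).

Let my : measurable_fun setT y.
Proof. by apply/measurable_EFinP; exact: measurable_int yi.1. Qed.

Let ge0_mul_parts (mu : {measure set T -> \bar R}) (g : R -> R) :
    measurable_fun setT g -> (forall t, 0 <= g t) ->
    mu.-integrable setT (EFin \o (fun x => g (q x) * y x)) ->
  [/\ mu.-integrable setT (EFin \o (fun x => g (q x) * y^\+ x)),
      mu.-integrable setT (EFin \o (fun x => g (q x) * y^\- x)) &
      \int[mu]_x (g (q x) * y x) =
      \int[mu]_x (g (q x) * y^\+ x) - \int[mu]_x (g (q x) * y^\- x)].
Proof.
move=> mg g0 gyi.
have normE x : y^\+ x + y^\- x = `|y x| by rewrite -[RHS](congr1 (@^~ x) (funrposDneg y)).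
have ip : mu.-integrable setT (EFin \o (fun x => g (q x) * y^\+ x)).
  apply: le_integrable (gyi) => //.
    apply/measurable_EFinP/measurable_funM; first exact: measurableT_comp.
    exact: measurable_funrpos.
  move=> x _; rewrite /= lee_fin !normrM ler_wpM2l//.
  by rewrite ger0_norm// -normE lerDl.
have ineg : mu.-integrable setT (EFin \o (fun x => g (q x) * y^\- x)).
  apply: le_integrable (gyi) => //.
    apply/measurable_EFinP/measurable_funM; first exact: measurableT_comp.
    exact: measurable_funrneg.
  move=> x _; rewrite /= lee_fin !normrM ler_wpM2l//.
  by rewrite ger0_norm// -normE lerDr.
split => //; rewrite -RintegralB//.
apply: eq_Rintegral => x _; rewrite -mulrBr; congr (_ * _).
by rewrite -[in LHS](funrposBneg y).
Qed.

(** Expanding (P - N)(y^+ - y^-), beta is the image of P y^+ + N y^- and alpha that of P y^- + N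
    y^+. The finite values u and v keep the difference meaningful. *)
Lemma signed_weighted_pushforward :
  exists alpha beta : {measure set R -> \bar R}, forall g : R -> R,
    measurable_fun setT g -> (forall t, 0 <= g t) ->
    diff_integrable (fun x => g (q x) * y x) ->
    exists u v, [/\ (\int[alpha]_t (g t)%:E = u%:E)%E,
      (\int[beta]_t (g t)%:E = v%:E)%E &
      v - u = diff_integral (fun x => g (q x) * y x)].
Proof.
have yp0 x : 0 <= y^\+ x by [].
have yn0 x : 0 <= y^\- x by [].
have [Pi Ni] := yi.
have [aP aPE] := weighted_pushforward yn0 (integrable_funrneg measurableT Pi) mq.
have [aN aNE] := weighted_pushforward yp0 (integrable_funrpos measurableT Ni) mq.
have [bP bPE] := weighted_pushforward yp0 (integrable_funrpos measurableT Pi) mq.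
have [bN bNE] := weighted_pushforward yn0 (integrable_funrneg measurableT Ni) mq.
exists [the {measure set R -> \bar R} of measure_add aP aN].
exists [the {measure set R -> \bar R} of measure_add bP bN] => g mg g0 [gPi gNi].
have [Pp Pn PE] := ge0_mul_parts mg g0 gPi.
have [Np Nn NE] := ge0_mul_parts mg g0 gNi.
have mg' : measurable_fun setT (EFin \o g) by exact/measurable_EFinP.
have g0' t : (0 <= (EFin \o g) t)%E by rewrite lee_fin.
have intE (mu : {measure set T -> \bar R}) (f : T -> R) :
    mu.-integrable setT (EFin \o (fun x => g (q x) * f x)) ->
    (\int[mu]_x ((EFin \o g) (q x) * (f x)%:E) = (\int[mu]_x (g (q x) * f x))%:E)%E.
  by move=> fi; rewrite /Rintegral fineK//; apply: integrable_fin_num.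
exists (\int[P]_x (g (q x) * y^\- x) + \int[N]_x (g (q x) * y^\+ x)).
exists (\int[P]_x (g (q x) * y^\+ x) + \int[N]_x (g (q x) * y^\- x)).
split.
- rewrite (ge0_integral_measure_add _ _ measurableT (fun t _ => g0' t))//.
  by rewrite (aPE (EFin \o g))// (aNE (EFin \o g))// !intE.
- rewrite (ge0_integral_measure_add _ _ measurableT (fun t _ => g0' t))//.
  by rewrite (bPE (EFin \o g))// (bNE (EFin \o g))// !intE.
- by rewrite /diff_integral PE NE; ring.
Qed.

(** The hypothesis says alpha <= beta on half-open intervals, so [measure_subtraction] gives tau
    with tau + alpha = beta; the integral against alpha is finite and can be subtracted. *)
Lemma positive_pushforward :
    (forall a b, a < b ->
      0 <= diff_integral (fun x => \1_(`]a, b]%classic) (q x) * y x)) ->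
  exists tau : {measure set R -> \bar R}, forall g : R -> R,
    measurable_fun setT g -> (forall t, 0 <= g t) ->
    diff_integrable (fun x => g (q x) * y x) ->
    (\int[tau]_t (g t)%:E = (diff_integral (fun x => g (q x) * y x))%:E)%E.
Proof.
move=> pos; have [alpha [beta ab]] := signed_weighted_pushforward.
have indic_int A : measurable A -> diff_integrable (fun x => \1_A (q x) * y x).
  have mA x : (`|(\1_A (q x) * y x)%:E| <= `|(y x)%:E|)%E.
    rewrite lee_fin normrM ler_piMl// indicE.
    by case: (_ \in _); rewrite ?normr1 ?normr0.
  move=> mA'; have mf : measurable_fun setT (EFin \o (fun x => \1_A (q x) * y x)).
    apply/measurable_EFinP/measurable_funM => //.
    by apply: (measurableT_comp (measurable_indic mA')).
  split.
  - exact: (le_integrable measurableT mf (fun x _ => mA x) yi.1).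
  - exact: (le_integrable measurableT mf (fun x _ => mA x) yi.2).
have fin (m : {measure set R -> \bar R}) u : (\int[m]_t (cst 1 t)%:E = u%:E)%E ->
    (m setT < +oo)%E.
  by rewrite (eq_integral (cst 1%E))// integral_cst// mul1e => ->; exact: ltry.
have c1 : diff_integrable (fun x => cst 1 (q x) * y x).
  have := indic_int _ measurableT; congr diff_integrable.
  by apply/funext => x; rewrite indicT.
(* The test function 1 shows that alpha and beta have finite mass. *)
have [u [v [u1 v1 _]]] := ab (cst 1) (measurable_cst _) (fun=> ler01) c1.
have sub a b : a < b -> (alpha `]a, b]%classic <= beta `]a, b]%classic)%E.
  move=> ltab; have mi := measurable_itv `]a, b].
  have [u' [v' []]] := ab _ (measurable_indic mi) (fun t => ltac:(by rewrite indicE))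
    (indic_int _ mi).
  rewrite !integral_indic// setIT => -> -> uv.
  by rewrite lee_fin -subr_ge0 uv pos.
have [tau tauE] := measure_subtraction (fin _ _ u1) (fin _ _ v1) sub.
exists tau => g mg g0 gi.
have [{u1}u [{v1}v [ug vg <-]]] := ab g mg g0 gi.
have g0' t : setT t -> (0 <= (g t)%:E)%E by rewrite lee_fin.
have mg' : measurable_fun setT (EFin \o g) by exact/measurable_EFinP.
have : (\int[tau]_t (g t)%:E + \int[alpha]_t (g t)%:E = v%:E)%E.
  rewrite -vg -ge0_integral_measure_add//.
  apply: eq_measure_integral => A mA _; rewrite -tauE//; exact: measure_addE.
by rewrite ug EFinB => <-; rewrite addeK.
Qed.

(** Dominated convergence with bound |y|, for P and N separately. *)
Lemma positive_of_trapezoid :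
    (forall a b n, 0 <= diff_integral (fun x => trapezoid a b n.+1 (q x) * y x)) ->
  forall a b, a < b ->
    0 <= diff_integral (fun x => \1_(`]a, b]%classic) (q x) * y x).
Proof.
move=> pos a b _.
pose f_ n x := trapezoid a b n.+1 (q x) * y x.
have mf_ n : measurable_fun setT (f_ n).
  apply: measurable_funM => //; apply: measurableT_comp => //.
  by apply: continuous_measurable_fun; exact: continuous_trapezoid.
have mf : measurable_fun setT (fun x => \1_(`]a, b]%classic) (q x) * y x).
  apply: measurable_funM => //.
  by apply: (measurableT_comp (measurable_indic (measurable_itv `]a, b]))).
have cvgf x : f_ n x @[n --> \oo] --> \1_(`]a, b]%classic) (q x) * y x.
  by apply: cvgM; [exact: cvg_trapezoid|exact: cvg_cst].
have domf n x : `|f_ n x| <= `|y x|.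
  rewrite normrM ler_piMl// ger0_norm; first exact: trapezoid_le1.
  exact: trapezoid_ge0.
have cvgi (mu : {measure set T -> \bar R}) : mu.-integrable setT (EFin \o y) ->
    \int[mu]_x f_ n x @[n --> \oo] -->
    \int[mu]_x (\1_(`]a, b]%classic) (q x) * y x).
  move=> iy; apply: Rintegral_dominated_cvg mf_ mf cvgf _ domf.
  exact: integrable_norm.
have cvgs : diff_integral (f_ n) @[n --> \oo] -->
    diff_integral (fun x => \1_(`]a, b]%classic) (q x) * y x).
  by apply: cvgB; apply: cvgi; [exact: yi.1|exact: yi.2].
apply: (cvgr_to_ge cvgs).
by apply: nearW => n; exact: pos.
Qed.

End signed_pushforward.

(** * Integration against a charge *)

Section signed_integral.
Context dT (T : measurableType dT) (R : realType).
Variable mu : {charge set T -> \bar R}.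
Local Notation P := (jordan_pos (hahn mu)).
Local Notation N := (jordan_neg (hahn mu)).

Definition charge_integrable (f : T -> R) : Prop := diff_integrable P N f.

Definition charge_integral (f : T -> R) : R := diff_integral P N f.

Lemma total_variation_integrable (f : T -> R) :
  (Defs.total_variation mu).-integrable setT (EFin \o f) -> charge_integrable f.
Proof.
move=> /integrableP[mf foo].
have mf' : measurable_fun setT (abse \o (EFin \o f)) by exact: measurableT_comp.
have addE : (\int[Defs.total_variation mu]_x `|(EFin \o f) x| =
    \int[P]_x `|(EFin \o f) x| + \int[N]_x `|(EFin \o f) x|)%E.
  rewrite -(ge0_integral_measure_add _ _ measurableT)//.
  by apply: eq_measure_integral => A mA _; exact/esym/measure_addE.
split; apply/integrableP; split => //; apply: le_lt_trans foo; rewrite addE.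
- by rewrite leeDl// integral_ge0.
- by rewrite leeDr// integral_ge0.
Qed.

Lemma charge_integral_indic A : measurable A -> (charge_integral \1_A)%:E = mu A.
Proof.
move=> mA; rewrite /charge_integral /diff_integral /Rintegral !integral_indic// !setIT.
rewrite EFinB !fineK ?fin_num_measure// (jordan_decomp (hahn mu) mA).
by rewrite -mulN1e.
Qed.

Lemma eq_charge_integral f g : f =1 g -> charge_integral f = charge_integral g.
Proof. by move=> /funext ->. Qed.

Lemma charge_integralD f g : charge_integrable f -> charge_integrable g ->
  charge_integral (fun x => f x + g x) = charge_integral f + charge_integral g.
Proof.
move=> [fP fN] [gP gN]; rewrite /charge_integral /diff_integral !RintegralD//; ring.
Qed.

Lemma charge_integralZ c f : charge_integrable f ->
  charge_integral (fun x => c * f x) = c * charge_integral f.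
Proof.
by move=> [fP fN]; rewrite /charge_integral /diff_integral !RintegralZl// mulrBr.
Qed.

Lemma charge_integrableD f g : charge_integrable f -> charge_integrable g ->
  charge_integrable (fun x => f x + g x).
Proof.
move=> [fP fN] [gP gN]; split.
- exact: integrableD fP gP.
- exact: integrableD fN gN.
Qed.

Lemma charge_integrableZ c f : charge_integrable f ->
  charge_integrable (fun x => c * f x).
Proof.
move=> [fP fN]; split.
- exact: integrableZl fP.
- exact: integrableZl fN.
Qed.

Lemma charge_integrable_le (f g : T -> R) : measurable_fun setT f -> (forall x, `|f x| <= `|g x|) ->
  charge_integrable g -> charge_integrable f.
Proof.
move=> mf fg [gP gN].
have mf' : measurable_fun setT (EFin \o f) by exact/measurable_EFinP.
have fg' x : setT x -> (`|(EFin \o f) x| <= `|(EFin \o g) x|)%E.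
  by move=> _; rewrite lee_fin.
by split; [exact: le_integrable mf' fg' gP|exact: le_integrable mf' fg' gN].
Qed.

Lemma charge_integral_dominated_cvg (f_ : nat -> T -> R) (f g : T -> R) :
    (forall n, measurable_fun setT (f_ n)) -> measurable_fun setT f ->
    (forall x, f_ n x @[n --> \oo] --> f x) ->
    charge_integrable g -> (forall n x, `|f_ n x| <= g x) ->
  charge_integral (f_ n) @[n --> \oo] --> charge_integral f.
Proof.
move=> mf_ mf cf [gP gN] fg.
by apply: cvgB; exact: (Rintegral_dominated_cvg mf_ mf cf _ fg).
Qed.

Lemma charge_cintegralE (f : T -> R[i]) : charge_cintegral mu f =
  charge_integral (@complex.Re R \o f) +i* charge_integral (@complex.Im R \o f).
Proof. by []. Qed.

End signed_integral.

(** * Radial measures and moments on balls *)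

Section radial.
Context (R : realType) (d : nat).
Local Notation C := R[i].
Local Notation Rd := (d.+1.-tuple R).
Local Notation S := (sqnorm_mpoly R d).
Implicit Types (x : Rd) (p : mpoly d.+1 C).

Definition sqenorm x : R := enorm x ^+ 2.

Lemma measurable_sqenorm : measurable_fun setT sqenorm.
Proof. by apply: measurable_funX; exact: measurable_enorm. Qed.

Lemma sqenormE x : sqenorm x = \sum_i tnth x i ^+ 2.
Proof. by rewrite /sqenorm sqr_sqrtr// sumr_ge0// => i _; exact: sqr_ge0. Qed.

Lemma sqenorm_ge0 x : 0 <= sqenorm x.
Proof. exact: sqr_ge0. Qed.

Lemma pevalM p p' x : peval (p * p') x = peval p x * peval p' x.
Proof. by rewrite /peval mevalM. Qed.

Lemma peval_sqnormX j x : peval (S ^+ j) x = (sqenorm x ^+ j)%:C.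
Proof.
rewrite sqenormE /peval !rmorphXn/=; congr (_ ^+ _).
rewrite /sqnorm_mpoly !rmorph_sum/=; apply: eq_bigr => i _.
by rewrite !rmorphXn/= mevalXU.
Qed.

Lemma peval_sqnormXM_real j p x : complex.Im (peval p x) = 0 ->
  peval (S ^+ j * p) x = (sqenorm x ^+ j * complex.Re (peval p x))%:C.
Proof.
by rewrite pevalM peval_sqnormX; case: (peval p x) => a b /= ->; rewrite -rmorphM.
Qed.

Section one_charge.
Variables (Y : harmonic_family R d) (mu : {charge set Rd -> \bar R}).
Hypotheses (imY : forall k l x, complex.Im (peval (tnth (Y k) l) x) = 0)
  (mmu : moment_measure mu) (pmu : pseudo_positive Y mu).

Lemma charge_integrable_Re p : charge_integrable mu (fun x => complex.Re (peval p x)).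
Proof. exact/total_variation_integrable/(mmu p).1. Qed.

Lemma charge_integrable_Im p : charge_integrable mu (fun x => complex.Im (peval p x)).
Proof. exact/total_variation_integrable/(mmu p).2. Qed.

Variables (k : nat) (l : 'I_(\dim (harmonics R d k))).
Let y x : R := complex.Re (peval (tnth (Y k) l) x).

Let yE x : peval (tnth (Y k) l) x = (y x)%:C.
Proof. by rewrite /y; case: (peval _ x) (imY l x) => a b /= ->. Qed.

(** Pseudo-positivity concerns functions of |x|, the image measure lives in the variable |x|^2; the
    function to test is therefore the trapezoid at r^2. *)
Lemma radial_trapezoid_ge0 a b n :
  0 <= charge_integral mu (fun x => trapezoid a b n.+1 (sqenorm x) * y x).
Proof.
have ct : continuous (fun r : R => trapezoid a b n.+1 (r ^+ 2)).
  move=> r; apply: (@continuous_comp _ _ _ (fun r : R => r ^+ 2)).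
    exact: exprn_continuous.
  exact: continuous_trapezoid.
have := pmu (h := fun r => trapezoid a b n.+1 (r ^+ 2)).
move=> /(_ (continuous_subspaceT ct)) /(_ (fun r _ => trapezoid_ge0 _ _ _ _)).
have cpt : compact (closure [set r : R | 0 <= r /\ trapezoid a b n.+1 (r ^+ 2) != 0]).
  (* If r > |b| + 2, then r^2 > b + 1, where the trapezoid vanishes. *)
  apply: (@subclosed_compact _ _ `[0, `|b| + 2]).
  - exact: closed_closure.
  - exact: segment_compact.
  have /closure_id -> : closed `[0, `|b| + 2]%classic by exact: itv_closed.
  apply: closureS => r [r0]; apply: contraR; rewrite /= in_itv/= r0/= -ltNge => rb.
  apply/eqP/trapezoid_out; have := ler_norm b; nra.
move=> /(_ cpt k l); rewrite charge_cintegralE lecE/= => /andP[_].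
rewrite (@eq_charge_integral _ _ _ _ _ (fun x => trapezoid a b n.+1 (sqenorm x) * y x))//.
by move=> x /=; rewrite yE -rmorphM.
Qed.

Lemma radial_measure : exists tau : {measure set R -> \bar R}, forall g : R -> R,
  measurable_fun setT g -> (forall t, 0 <= g t) ->
  charge_integrable mu (fun x => g (sqenorm x) * y x) ->
  (\int[tau]_t (g t)%:E = (charge_integral mu (fun x => g (sqenorm x) * y x))%:E)%E.
Proof.
apply: positive_pushforward.
- exact: charge_integrable_Re.
- exact: measurable_sqenorm.
- apply: positive_of_trapezoid.
  + exact: charge_integrable_Re.
  + exact: measurable_sqenorm.
  + exact: radial_trapezoid_ge0.
Qed.

(** The integral formula is kept beside the moment property because, after determinacy, it is
    applied to functions that are not polynomials. *)
Lemma radial_stieltjes_solution (T : {scalar mpoly d.+1 C}) :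
    (forall f, T f = charge_cintegral mu (peval f)) ->
  exists tau : {measure set R -> \bar R},
    stieltjes_solution (radial_functional T (tnth (Y k) l)) tau /\
    forall g : R -> R, measurable_fun setT g -> (forall t, 0 <= g t) ->
      charge_integrable mu (fun x => g (sqenorm x) * y x) ->
      (\int[tau]_t (g t)%:E =
       (charge_integral mu (fun x => g (sqenorm x) * y x))%:E)%E.
Proof.
move=> Tmu; have [tau tauE] := radial_measure; exists tau; split=> //.
(* The formula for tau asks for functions that are non-negative on all of R; cutting r^m at 0 is
   invisible at r = |x|^2. *)
pose g m (r : R) : R := \1_(`[0, +oo[%classic) r * r ^+ m.
have g0 m r : 0 <= g m r.
  rewrite /g indicE; have [|_] := boolP (r \in _); last by rewrite mul0r.
  by rewrite inE/= in_itv/= andbT mul1r => r0; exact: exprn_ge0.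
have mg m : measurable_fun setT (g m).
  apply: measurable_funM; last exact: exprn_measurable.
  by apply: measurable_indic; exact: measurable_itv.
have gE m x : g m (sqenorm x) * y x = complex.Re (peval (S ^+ m * tnth (Y k) l) x).
  rewrite peval_sqnormXM_real//= /g indicE mem_set ?mul1r//=.
  by rewrite in_itv/= sqenorm_ge0.
have gi m : charge_integrable mu (fun x => g m (sqenorm x) * y x).
  by under eq_fun do rewrite gE; exact: charge_integrable_Re.
have gint m : (\int[tau]_(r in `[0%R, +oo[) (r ^+ m)%:E =
    (charge_integral mu (fun x => complex.Re (peval (S ^+ m * tnth (Y k) l) x)))%:E)%E.
  under [in RHS]eq_charge_integral do rewrite -gE.
  rewrite -tauE// integral_mkcond; apply: eq_integral => r _.
  by rewrite patchE /g indicE; case: ifPn => _; rewrite ?mul1r ?mul0r.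
split.
- have mi := measurable_itv `]-oo, (0 : R)[.
  have y0 x : \1_(`]-oo, (0 : R)[%classic) (sqenorm x) * y x = 0 * y x.
    by rewrite indicE memNset//= in_itv/= ltNge sqenorm_ge0.
  have i0 : charge_integrable mu (fun x => \1_(`]-oo, (0 : R)[%classic) (sqenorm x) * y x).
    under eq_fun do rewrite y0 mul0r.
    apply: (charge_integrable_le _ _ (charge_integrable_Re (tnth (Y k) l))) => // x.
    by rewrite normr0.
  have := tauE _ (measurable_indic mi) (fun t => ltac:(by rewrite indicE)) i0.
  rewrite (eq_charge_integral _ y0) integral_indic// setIT => ->.
  rewrite charge_integralZ ?mul0r//; exact: (charge_integrable_Re (tnth (Y k) l)).
- move=> m; apply/integrableP; split.
    apply/measurable_EFinP; apply: measurable_funTS; exact: exprn_measurable.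
  rewrite (eq_integral (fun r : R => (r ^+ m)%:E)).
    by rewrite gint ltry.
  by move=> r; rewrite inE/= in_itv/= andbT => r0; rewrite ger0_norm// exprn_ge0.
- move=> m; rewrite /Rintegral gint/= /radial_functional rmorphXn/= horner_algX Tmu.
  rewrite charge_cintegralE; apply/eqP; rewrite eq_complex/= eqxx/=.
  (* The vanishing imaginary part is written 0 * y so that linearity gives the integral 0. *)
  rewrite (@eq_charge_integral _ _ _ _ _ (fun x => 0 * y x)).
    rewrite charge_integralZ ?mul0r//; exact: (charge_integrable_Re (tnth (Y k) l)).
  by move=> x /=; rewrite peval_sqnormXM_real ?mul0r.
Qed.

End one_charge.

(** Here [rho] bounds the squared norm, the variable of the image measures. *)
Definition ball_integral (mu : {charge set Rd -> \bar R}) (rho : R) (f : Rd -> R) : R :=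
  charge_integral mu (fun x => \1_(`[0, rho]%classic) (sqenorm x) * f x).

Lemma charge_integrable_ball (mu : {charge set Rd -> \bar R}) rho (f : Rd -> R) :
  charge_integrable mu f ->
  charge_integrable mu (fun x => \1_(`[0, rho]%classic) (sqenorm x) * f x).
Proof.
move=> fi; apply: charge_integrable_le (fi).
- apply: measurable_funM; last by apply/measurable_EFinP; exact: measurable_int fi.1.
  apply: measurableT_comp measurable_sqenorm.
  by apply: measurable_indic; exact: measurable_itv.
- move=> x; rewrite normrM ler_piMl// indicE.
  by case: (_ \in _); rewrite ?normr1 ?normr0.
Qed.

Lemma ball_integralD (mu : {charge set Rd -> \bar R}) rho (f g : Rd -> R) :
    charge_integrable mu f -> charge_integrable mu g ->
  ball_integral mu rho (fun x => f x + g x) =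
  ball_integral mu rho f + ball_integral mu rho g.
Proof.
move=> fi gi; rewrite -charge_integralD; try exact: charge_integrable_ball.
by apply: eq_charge_integral => x; rewrite mulrDr.
Qed.

Lemma ball_integralZ (mu : {charge set Rd -> \bar R}) rho c (f : Rd -> R) :
    charge_integrable mu f ->
  ball_integral mu rho (fun x => c * f x) = c * ball_integral mu rho f.
Proof.
move=> fi; rewrite -charge_integralZ; last exact: charge_integrable_ball.
by apply: eq_charge_integral => x; rewrite mulrCA.
Qed.

Lemma ball_integral0 (mu : {charge set Rd -> \bar R}) rho (f : Rd -> R) :
  (forall x, f x = 0) -> ball_integral mu rho f = 0.
Proof.
move=> f0; rewrite /ball_integral /charge_integral /diff_integral /Rintegral.
by under eq_integral do rewrite f0 mulr0; rewrite integral0;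
  under eq_integral do rewrite f0 mulr0; rewrite integral0 subrr.
Qed.

(** * Equality of the polynomial moments of two solutions on balls *)

Section two_charges.
Variables (Y : harmonic_family R d) (T : {scalar mpoly d.+1 C}).
Hypotheses (bY : forall k, basis_of (harmonics R d k) (Y k))
  (imY : forall k l x, complex.Im (peval (tnth (Y k) l) x) = 0)
  (hdet : forall k l, stieltjes_determined (radial_functional T (tnth (Y k) l))).
Variables mu nu : {charge set Rd -> \bar R}.
Hypotheses (mmu : moment_measure mu) (pmu : pseudo_positive Y mu)
  (Tmu : forall f, T f = charge_cintegral mu (peval f))
  (mnu : moment_measure nu) (pnu : pseudo_positive Y nu)
  (Tnu : forall f, T f = charge_cintegral nu (peval f)).

(** Determinacy enters here: the image measures of both charges solve the same Stieltjes problem, so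
    they agree on 1_[0, rho](t) t^j. *)
Lemma ball_integral_sqnormXM rho j k l :
  ball_integral mu rho (fun x => complex.Re (peval (S ^+ j * tnth (Y k) l) x)) =
  ball_integral nu rho (fun x => complex.Re (peval (S ^+ j * tnth (Y k) l) x)).
Proof.
have [tau [tau_sol tauE]] := radial_stieltjes_solution imY mmu pmu l Tmu.
have [sig [sig_sol sigE]] := radial_stieltjes_solution imY mnu pnu l Tnu.
have tau_sig := (hdet l).2 _ _ tau_sol sig_sol.
pose g (r : R) : R := \1_(`[0, rho]%classic) r * r ^+ j.
have g0 r : 0 <= g r.
  rewrite /g indicE; have [|_] := boolP (r \in _); last by rewrite mul0r.
  by rewrite inE/= in_itv/= => /andP[r0 _]; rewrite mul1r exprn_ge0.
have mg : measurable_fun setT g.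
  apply: measurable_funM; last exact: exprn_measurable.
  by apply: measurable_indic; exact: measurable_itv.
have gE x : g (sqenorm x) * complex.Re (peval (tnth (Y k) l) x) =
    \1_(`[0, rho]%classic) (sqenorm x) *
    complex.Re (peval (S ^+ j * tnth (Y k) l) x).
  by rewrite peval_sqnormXM_real// /g mulrA.
have gi (m : {charge set Rd -> \bar R}) : moment_measure m ->
    charge_integrable m (fun x => g (sqenorm x) * complex.Re (peval (tnth (Y k) l) x)).
  move=> mm; under eq_fun do rewrite gE.
  exact/charge_integrable_ball/charge_integrable_Re.
apply/EFin_inj; rewrite /ball_integral.
under eq_charge_integral do rewrite -gE.
under [in RHS]eq_charge_integral do rewrite -gE.
rewrite -(tauE g mg g0 (gi _ mmu)) -(sigE g mg g0 (gi _ mnu)).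
by apply: eq_measure_integral => A mA _; exact: tau_sig.
Qed.

Lemma ball_integral_mpoly rho p :
  ball_integral mu rho (fun x => complex.Re (peval p x)) =
  ball_integral nu rho (fun x => complex.Re (peval p x)).
Proof.
(* Multiplication by a complex scalar mixes real and imaginary parts, so both are carried through
   the induction. *)
suff [] : ball_integral mu rho (fun x => complex.Re (peval p x)) =
    ball_integral nu rho (fun x => complex.Re (peval p x)) /\
  ball_integral mu rho (fun x => complex.Im (peval p x)) =
    ball_integral nu rho (fun x => complex.Im (peval p x)) by [].
move: p; apply: (sqnorm_harmonic_ind bY) => [|c p p' [pR pI] [p'R p'I]|j k l].
- by split; rewrite !ball_integral0// => x; rewrite /peval meval0.
- have ReE x : complex.Re (peval (c *: p + p') x) =
      complex.Re c * complex.Re (peval p x) +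
      (- complex.Im c * complex.Im (peval p x) + complex.Re (peval p' x)).
    rewrite /peval mevalD mevalZ -!/(peval _ _).
    by case: (c) (peval p x) (peval p' x) => [? ?] [? ?] [? ?] /=; ring.
  have ImE x : complex.Im (peval (c *: p + p') x) =
      complex.Re c * complex.Im (peval p x) +
      (complex.Im c * complex.Re (peval p x) + complex.Im (peval p' x)).
    rewrite /peval mevalD mevalZ -!/(peval _ _).
    by case: (c) (peval p x) (peval p' x) => [? ?] [? ?] [? ?] /=; ring.
  have linB (m : {charge set Rd -> \bar R}) a b (f g h : Rd -> R) : moment_measure m ->
      charge_integrable m f -> charge_integrable m g -> charge_integrable m h ->
      ball_integral m rho (fun x => a * f x + (b * g x + h x)) =
      a * ball_integral m rho f + (b * ball_integral m rho g + ball_integral m rho h).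
    move=> mm fi gi hi; have afi := charge_integrableZ a fi; have bgi := charge_integrableZ b gi.
    rewrite (ball_integralD _ afi (charge_integrableD bgi hi)) (ball_integralD _ bgi hi).
    by rewrite !ball_integralZ.
  have Ri (m : {charge set Rd -> \bar R}) q : moment_measure m ->
      charge_integrable m (fun x => complex.Re (peval q x)).
    by move=> mm; exact: charge_integrable_Re.
  have Ii (m : {charge set Rd -> \bar R}) q : moment_measure m ->
      charge_integrable m (fun x => complex.Im (peval q x)).
    by move=> mm; exact: charge_integrable_Im.
  by rewrite (funext ReE) (funext ImE) !linB ?pR ?pI ?p'R ?p'I//; auto.
- split; first exact: ball_integral_sqnormXM.
  by rewrite !ball_integral0// => x; rewrite peval_sqnormXM_real.
Qed.

End two_charges.
End radial.

(** * Uniqueness *)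

(** Moving the negative parts across, mu = nu becomes P mu + N nu = P nu + N mu, an equality of
    finite measures, to which uniqueness on a pi-system applies. *)
Lemma charge_unique dT (T : measurableType dT) (R : realType)
    (G : set (set T)) (g : (set T)^nat) (mu nu : {charge set T -> \bar R}) :
    measurable = <<s G >> -> setI_closed G -> (forall i, G (g i)) ->
    \bigcup_k g k = setT -> (forall A, G A -> mu A = nu A) ->
  forall A, measurable A -> mu A = nu A.
Proof.
move=> mG IG Gg gT munu A mA.
pose P (m : {charge set T -> \bar R}) := jordan_pos (hahn m).
pose N (m : {charge set T -> \bar R}) := jordan_neg (hahn m).
have chargeE (m : {charge set T -> \bar R}) B : measurable B ->
    exists p n, [/\ P m B = p%:E, N m B = n%:E & m B = (p - n)%:E].
  move=> mB; exists (fine (P m B)), (fine (N m B)).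
  rewrite EFinB !fineK ?fin_num_measure//; split => //.
  by rewrite (jordan_decomp (hahn m) mB) -mulN1e.
have GM B : G B -> measurable B by rewrite mG; exact: sub_sigma_algebra.
pose m1 : {measure set T -> \bar R} := measure_add (P mu) (N nu).
pose m2 : {measure set T -> \bar R} := measure_add (P nu) (N mu).
have m1E B : m1 B = (P mu B + N nu B)%E by exact: measure_addE.
have m2E B : m2 B = (P nu B + N mu B)%E by exact: measure_addE.
have : m1 A = m2 A.
  apply: (measure_unique G g) => // [B GB|k].
    have [p [n [pE nE E]]] := chargeE mu B (GM _ GB).
    have [p' [n' [pE' nE' E']]] := chargeE nu B (GM _ GB).
    rewrite m1E m2E pE nE pE' nE'; have := munu _ GB.
    rewrite E E' => -[h]; rewrite -!EFinD; congr (_%:E); lra.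
  have [p [n [pE nE E]]] := chargeE mu _ (GM _ (Gg k)).
  have [p' [n' [pE' nE' E']]] := chargeE nu _ (GM _ (Gg k)).
  by rewrite m1E pE nE' -EFinD ltry.
have [p [n [pE nE ->]]] := chargeE mu A mA.
have [p' [n' [pE' nE' ->]]] := chargeE nu A mA.
rewrite m1E m2E pE nE pE' nE' -!EFinD => -[h]; congr (_%:E); lra.
Qed.

(** * A generating pi-system of balls cut by half-spaces *)

Section halfspaces.
Context (R : realType) (d : nat).
Local Notation C := R[i].
Local Notation Rd := (d.+1.-tuple R).
Implicit Types (x : Rd) (s : seq ('I_d.+1 * R)).

(** Indexed by lists, so that concatenation is intersection and the empty list gives the whole
    space. *)
Definition halfspaces s : set Rd := [set x | all (fun ic => tnth x ic.1 < ic.2) s].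

Definition sqball (rho : R) : set Rd := @sqenorm R d @^-1` `[0, rho].

Lemma measurable_sqball rho : measurable (sqball rho).
Proof. by rewrite -[X in measurable X]setTI; exact: measurable_sqenorm. Qed.

Lemma measurable_halfspaces s : measurable (halfspaces s).
Proof.
elim: s => [|[i c] s IH]; first by rewrite (_ : halfspaces _ = setT)//; apply/seteqP; split.
rewrite (_ : halfspaces _ = (fun x => tnth x i) @^-1` `]-oo, c[ `&` halfspaces s).
  apply: measurableI => //; rewrite -[X in measurable X]setTI.
  exact: measurable_tnth.
apply/seteqP; split => x /=; rewrite /halfspaces/= in_itv/=; first by move/andP.
by move=> [-> ->].
Qed.

Lemma bigcup_sqball : \bigcup_(k : nat) sqball k%:R = setT.
Proof.
rewrite -subTset => x _; exists (Num.bound (sqenorm x)) => //.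
rewrite /sqball/= in_itv/= sqenorm_ge0 ltW//.
by apply: archi_boundP; exact: sqenorm_ge0.
Qed.

(** Each {x_i < c} is the union over k of its traces on the balls [sqball k%:R], so the coordinates
    are measurable for the generated sigma-algebra. *)
Lemma measurable_tupleE :
  measurable = <<s [set sqball rs.1 `&` halfspaces rs.2 | rs in setT] >> :> set (set Rd).
Proof.
set G := [set _ | _ in _]; apply/seteqP; split; last first.
  apply: smallest_sub; first exact: sigma_algebra_measurable.
  move=> _ [[rho s] _ <-] /=; apply: measurableI; first exact: measurable_sqball.
  exact: measurable_halfspaces.
pose GT := g_sigma_algebraType G.
have mcoord (i : 'I_d.+1) : measurable_fun (setT : set GT) (fun x => tnth (x : Rd) i).
  apply: (measurability _ (RGenInftyO.measurableE R)).
  move=> _ [_ [c ->] <-]; rewrite setTI.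
  rewrite (_ : _ @^-1` _ = \bigcup_k (sqball k%:R `&` halfspaces [:: (i, c)])).
    apply: (@bigcupT_measurable _ GT) => k; apply: sub_sigma_algebra.
    by exists (k%:R, [:: (i, c)]).
  rewrite -setI_bigcupl bigcup_sqball setTI.
  by apply/seteqP; split => x; rewrite /halfspaces/= in_itv/= andbT.
apply: smallest_sub; first exact: smallest_sigma_algebra.
move=> A; rewrite -bigcup_seq => -[i _ [B mB <-]].
exact: mcoord.
Qed.

(* Affine, increasing, with value 1/2 at [c] and values in [0, 1] for          *)
(* [|t| <= 1 + r].                                                            *)
Definition rescale (r c : R) (t : R) : R := 2^-1 + (t - c) / (2 * (1 + r + `|c|)).

(** The polynomial form of [poly_step k] after [rescale]; the affine map is entered through its
    slope and its value at 0. *)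
Definition step_mpoly r k (ic : 'I_d.+1 * R) : mpoly d.+1 C :=
  (1 - (((2 * (1 + r + `|ic.2|))^-1)%:C *: mpolyX C (mnm1 ic.1) +
        mpolyC d.+1 (rescale r ic.2 0)%:C) ^+ k) ^+ (k * 2 ^ k).

Lemma peval_step_mpoly r k ic x :
  peval (step_mpoly r k ic) x = (poly_step k (rescale r ic.2 (tnth x ic.1)))%:C.
Proof.
rewrite /peval /step_mpoly /poly_step !(rmorphXn, rmorphB, rmorph1)/=; congr ((1 - _ ^+ _) ^+ _).
rewrite mevalD mevalZ mevalXU mevalC -rmorphM -rmorphD/=; congr (_%:C).
rewrite /rescale; ring.
Qed.

Lemma rescale01 r c t : 0 <= r -> `|t| <= 1 + r -> 0 <= rescale r c t <= 1.
Proof.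
move=> r0 tr; rewrite /rescale; set M := 1 + r + `|c|.
have c0 := normr_ge0 c; have M0 : 0 < 2 * M by rewrite /M; lra.
have : `|t - c| <= M by rewrite (le_trans (ler_normB _ _))// lerD2r.
rewrite ler_norml => /andP[lo hi].
have h1 : (t - c) / (2 * M) <= 2^-1 by rewrite ler_pdivrMr//; lra.
have h2 : - 2^-1 <= (t - c) / (2 * M) by rewrite ler_pdivlMr//; lra.
apply/andP; split; lra.
Qed.

Lemma rescale_lt r c t : 0 <= r -> (rescale r c t < 2^-1) = (t < c).
Proof.
move=> r0; rewrite /rescale -ltrBrDl subrr; have c0 := normr_ge0 c.
by rewrite pmulr_llt0 ?subr_lt0// invr_gt0; lra.
Qed.

(** From a^2 <= rho and (a - 1)^2 >= 0 follows 2a <= 1 + rho for a = |x_i|; this rough bound avoids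
    square roots and fits [rescale]. *)
Lemma norm_tnth_sqball rho x i : sqball rho x -> `|tnth x i| <= 1 + rho.
Proof.
rewrite /sqball/= in_itv/= => /andP[_]; rewrite sqenormE (bigD1 i)//=.
set s := \sum_(_ < _ | _) _ => h.
have s0 : 0 <= s by apply: sumr_ge0 => j _; exact: sqr_ge0.
have : `|tnth x i| ^+ 2 <= rho by rewrite real_normK ?num_real//; lra.
have := sqr_ge0 (`|tnth x i| - 1); rewrite !expr2; have := normr_ge0 (tnth x i); nra.
Qed.

Lemma sqball_ge0 rho x : sqball rho x -> 0 <= rho.
Proof. by rewrite /sqball/= in_itv/= => /andP[]; exact: le_trans. Qed.

Variables mu nu : {charge set Rd -> \bar R}.
Hypotheses (mmu : moment_measure mu) (mnu : moment_measure nu).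
Hypothesis ballE : forall rho p,
  ball_integral mu rho (fun x => complex.Re (peval p x)) =
  ball_integral nu rho (fun x => complex.Re (peval p x)).

(** The product of the step polynomials of the half-spaces, cut to the ball, converges pointwise to
    the indicator and is bounded by 1, which is integrable because charges are finite; equal moments
    on the ball pass to the limit. *)
Lemma charge_sqball_halfspaces rho s :
  mu (sqball rho `&` halfspaces s) = nu (sqball rho `&` halfspaces s).
Proof.
pose p k := \prod_(ic <- s) step_mpoly rho k ic.
pose F k x := \prod_(ic <- s) poly_step k (rescale rho ic.2 (tnth x ic.1)).
have pE k x : peval (p k) x = (F k x)%:C.
  rewrite /peval rmorph_prod /F rmorph_prod/=; apply: eq_bigr => ic _.
  exact: peval_step_mpoly.
pose f_ k x := \1_(`[0, rho]%classic) (sqenorm x) * F k x.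
pose f x : R := \1_(sqball rho `&` halfspaces s) x.
have f_E (m : {charge set Rd -> \bar R}) k :
    charge_integral m (f_ k) = ball_integral m rho (fun x => complex.Re (peval (p k) x)).
  by apply: eq_charge_integral => x; rewrite pE.
have mf_ k : measurable_fun setT (f_ k).
  apply/measurable_EFinP.
  have -> : f_ k = fun x => \1_(`[0, rho]%classic) (sqenorm x) * complex.Re (peval (p k) x).
    by apply/funext => x; rewrite pE.
  exact: measurable_int (charge_integrable_ball _ (charge_integrable_Re mmu (p k))).1.
have mG : measurable (sqball rho `&` halfspaces s).
  by apply: measurableI; [exact: measurable_sqball|exact: measurable_halfspaces].
have mf : measurable_fun setT f by exact: measurable_indic.
(* Only on the ball do the rescaled coordinates lie in [0, 1]; elsewhere the indicator factor of
   [f_] is 0. *)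
have in01 k x : sqball rho x -> 0 <= F k x <= 1.
  move=> xB; have h ic : 0 <= poly_step k (rescale rho ic.2 (tnth x ic.1)) <= 1.
    have r01 := rescale01 ic.2 (sqball_ge0 xB) (norm_tnth_sqball ic.1 xB).
    by rewrite poly_step_ge0// poly_step_le1.
  apply/andP; split; first by apply: prodr_ge0 => ic _; case/andP: (h ic).
  by apply: prodr_ile1 => ic _.
have cvgf x : f_ k x @[k --> \oo] --> f x.
  rewrite /f_ /f indicE; have [|xB] := boolP (_ \in _); last first.
    rewrite indicE memNset => [|[xB' _]]; last by rewrite mem_set in xB.
    by under eq_fun do rewrite mul0r; exact: cvg_cst.
  rewrite inE => xB; have -> : \1_(sqball rho `&` halfspaces s) x =
      1 * \prod_(ic <- s) ((tnth x ic.1 < ic.2)%R%:R : R).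
    rewrite mul1r indicE (_ : (_ \in _) = all (fun ic => tnth x ic.1 < ic.2) s); last first.
      by apply/idP/idP => [/set_mem[]//|xs]; exact/mem_set.
    elim: (s) => [|ic s' IH]; first by rewrite big_nil.
    by rewrite big_cons /= -IH; case: (_ < _); rewrite ?mul1r ?mul0r.
  apply: cvgM; first exact: cvg_cst.
  rewrite /F; elim: (s) => [|ic s' IH].
    by under eq_fun do rewrite big_nil; rewrite big_nil; exact: cvg_cst.
  under eq_fun do rewrite big_cons; rewrite big_cons; apply: cvgM => //.
  rewrite -(rescale_lt ic.2 _ (sqball_ge0 xB)); apply: cvg_poly_step.
  exact: rescale01 (sqball_ge0 xB) (norm_tnth_sqball _ xB).
have domf k x : `|f_ k x| <= 1.
  rewrite /f_ indicE; have [|_] := boolP (_ \in _); last by rewrite mul0r normr0.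
  by rewrite inE mul1r => /(in01 k)/andP[F0 F1]; rewrite ger0_norm.
have cvgm (m : {charge set Rd -> \bar R}) :
    charge_integral m (f_ k) @[k --> \oo] --> charge_integral m f.
  apply: (charge_integral_dominated_cvg mf_ mf cvgf (g := cst 1)) => //.
  by split; exact: finite_measure_integrable_cst.
(* The approximating integrals for nu are replaced by those for mu, so one sequence has both
   limits. *)
have := cvgm nu; under eq_fun do rewrite f_E -ballE -f_E.
move=> cvg_nu; rewrite -!charge_integral_indic//; congr (_%:E).
exact: (cvg_unique _ (cvgm mu) cvg_nu).
Qed.

End halfspaces.

Theorem theorem16 (R : realType) (d : nat) (Y : harmonic_family R d)
    (hY : real_orthonormal_basis Y)
    (T : {scalar mpoly d.+1 R[i]})
    (hT : pseudo_positive_definite Y T)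
    (hdet : forall k l, stieltjes_determined (radial_functional T (tnth (Y k) l)))
    (mu nu : {charge set (d.+1.-tuple R) -> \bar R}) :
  moment_measure mu -> pseudo_positive Y mu ->
  (forall f, T f = charge_cintegral mu (peval f)) ->
  moment_measure nu -> pseudo_positive Y nu ->
  (forall f, T f = charge_cintegral nu (peval f)) ->
  forall A, measurable A -> mu A = nu A.
Proof.
move=> mmu pmu Tmu mnu pnu Tnu.
have bY k : basis_of (harmonics R d k) (Y k) by have [] := hY k.
have imY k l x : complex.Im (peval (tnth (Y k) l) x) = 0 by have [_ + _] := hY k.
apply: (charge_unique (g := fun k : nat => sqball k%:R) (@measurable_tupleE R d)).
(* Concentric balls intersect in the smaller one, and the lists of half-spaces concatenate. *)
- move=> _ _ [[r s] _ <-] [[r' s'] _ <-]; exists (Num.min r r', s ++ s') => //=.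
  apply/seteqP; split => x; rewrite /sqball /halfspaces/= !in_itv/= all_cat le_min.
    by move=> [/andP[-> /andP[-> ->]] /andP[-> ->]].
  by move=> [[/andP[-> ->] ->] [/andP[_ ->] ->]].
- move=> k; exists (k%:R, [::]) => //=; rewrite (_ : halfspaces _ = setT) ?setIT//.
  by apply/seteqP; split.
- exact: bigcup_sqball.
move=> _ [[r s] _ <-] /=; apply: charge_sqball_halfspaces => // rho p.
exact: (ball_integral_mpoly bY imY hdet).
Qed.
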